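(* For every integer $t$ there are constants $k_t, m_t$ and a finite set $\Delta_t$ of first-order formulas in the language of ordered graphs, each with $k_t+1$ free variables, such that for every $t$-mixed free ordered graph $(G,\preceq)$ and every non-empty $A \subseteq V(G)$ there are functions $f : V(G) \to A^{k_t}$ and $g : V(G) \to \Delta_t$ such that: (i) $|f(V(G))| \le m_t |A|$; (ii) for all $v \in V(G)$, $(G,\preceq) \models g(v)(v, f(v))$; (iii) for all $v, v' \in V(G)$, if $(G,\preceq) \models g(v)(v', f(v))$ then $N_A(v) = N_A(v')$.
   Context: Graphs are finite, undirected and simple; $N_A(v)$ is the set of neighbors of $v$ in $A$. An ordered graph is a pair $(G,\preceq)$ with $\preceq$ a total order on $V(G)$; the language of ordered graphs has the binary relation symbols $E$ (adjacency) and $\preceq$. If $V(G)=\{v_1,\dots,v_n\}$ listed in $\preceq$-order, $M_\preceq(G)$ is the $n\times n$ adjacency matrix with $M[i][j]=1$ iff $v_iv_j \in E(G)$. A matrix is vertical if all rows are equal, horizontal if all columns are equal, mixed if neither. A $(t,t)$-division of a matrix partitions its rows into $t$ non-empty sets of consecutive rows and its columns into $t$ non-empty sets of consecutive columns; a $t$-mixed minor is a $(t,t)$-division in which every zone (row part $\times$ column part) is a mixed submatrix. $(G,\preceq)$ is $t$-mixed free if $M_\preceq(G)$ has no $t$-mixed minor. *)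

(* Defs.v *)
From mathcomp Require Import all_boot all_order all_algebra.
Set Implicit Arguments.
Unset Strict Implicit.
Unset Printing Implicit Defensive.

Section Matrices.
Variable T : eqType.

Definition vertical m n (M : 'M[T]_(m, n)) : bool :=
  [forall i, forall i', row i M == row i' M].

Definition horizontal m n (M : 'M[T]_(m, n)) : bool :=
  [forall j, forall j', col j M == col j' M].

Definition mixed m n (M : 'M[T]_(m, n)) : bool :=
  ~~ vertical M && ~~ horizontal M.

Definition zone m n (M : 'M[T]_(m, n)) (X : {set 'I_m}) (Y : {set 'I_n}) :
    'M[T]_(#|X|, #|Y|) :=
  mxsub (@enum_val _ (mem X)) (@enum_val _ (mem Y)) M.

Definition consecutive n (X : {set 'I_n}) : bool :=
  [forall i in X, forall k in X, forall j : 'I_n, (i <= j <= k) ==> (j \in X)].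

(* The non-emptiness of the parts is included in [partition]. *)
Definition consecutive_partition n t (P : {set {set 'I_n}}) : bool :=
  [&& partition P [set: 'I_n], #|P| == t & [forall X in P, consecutive X]].

Definition mixed_minor t m n (M : 'M[T]_(m, n))
    (P : {set {set 'I_m}}) (Q : {set {set 'I_n}}) : bool :=
  [&& consecutive_partition t P, consecutive_partition t Q &
      [forall X in P, forall Y in Q, mixed (zone M X Y)]].
End Matrices.

Definition simple_graph (V : finType) (E : rel V) : Prop :=
  symmetric E /\ irreflexive E.

Definition neighbors (V : finType) (E : rel V) (A : {set V}) (v : V) : {set V} :=
  [set a in A | E v a].

Section OrderedGraphs.
Variables (d : Order.disp_t) (V : finOrderType d) (E : rel V).

(* [Order.enum_val] lists the vertices in increasing order. *)
Definition adj_matrix : 'M[bool]_#|V| :=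
  \matrix_(i, j) E (Order.enum_val i) (Order.enum_val j).

Definition mixed_free (t : nat) : Prop :=
  ~ exists P Q : {set {set 'I_#|V|}}, mixed_minor t adj_matrix P Q.
End OrderedGraphs.

(* First-order formulas whose free variables are among n variables, indexed by
   'I_n; a quantifier binds the variable 0 of its body and shifts the others. *)
Inductive formula : nat -> Type :=
| Adj n of 'I_n & 'I_n : formula n
| Leq n of 'I_n & 'I_n : formula n
| Equ n of 'I_n & 'I_n : formula n
| Bot n : formula n
| Not n of formula n : formula n
| And n of formula n & formula n : formula n
| Or n of formula n & formula n : formula n
| Ex n of formula n.+1 : formula n
| All n of formula n.+1 : formula n.

Fixpoint sat d (V : finOrderType d) (E : rel V) n (phi : formula n) :
    n.-tuple V -> bool :=
  match phi in formula n return n.-tuple V -> bool with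
  | Adj _ i j => fun w => E (tnth w i) (tnth w j)
  | Leq _ i j => fun w => (tnth w i <= tnth w j)%O
  | Equ _ i j => fun w => tnth w i == tnth w j
  | Bot _ => fun _ => false
  | Not _ p => fun w => ~~ sat E p w
  | And _ p q => fun w => sat E p w && sat E q w
  | Or _ p q => fun w => sat E p w || sat E q w
  | Ex _ p => fun w => [exists x, sat E p (cons_tuple x w)]
  | All _ p => fun w => [forall x, sat E p (cons_tuple x w)]
  end.

(* Main.v *)
(** Call a pair of consecutive columns of [A] bad on a set of rows if the rows
    and the two columns span a mixed submatrix. Along a pair which is not bad,
    agreement of two rows at one column passes to the other, so on a set of rows
    with at most [p] bad pairs the trace on [A] is determined by the adjacency to
    at most [p.+1] elements of [A]. It remains to cut the vertices into at most
    [#|A|] intervals with few bad pairs, each definable with boundedly many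
    parameters from [A].

    Definability: fix [t] disjoint pairs of columns and cut the vertices greedily
    into intervals which are mixed with all of them. Mixed freeness bounds the
    number of greedy cuts, so each is definable from the pairs alone, and an
    interval avoiding the cuts of all choices of pairs has fewer than [2t] bad
    pairs.

    Counting: merge the intervals so obtained greedily while at most [p] pairs
    are bad. If this produced [#|A|] intervals, the 0/1 matrix recording which
    pairs are bad on which interval would have more than [p * #|A|] ones, and
    the Marcus-Tardos theorem would yield a mixed minor. *)

Require Import Defs.
From Stdlib Require List.
From mathcomp Require Import all_boot all_order all_algebra.
From mathcomp Require Import zify.
Set Implicit Arguments.
Unset Strict Implicit.
Unset Printing Implicit Defensive.
Import Order.TTheory.

(** * The Marcus-Tardos theorem *)

(** Only the values of [r] and [c] up to [k] matter. Every zone contains an entry, which forces them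
    to increase there, so monotonicity is not demanded. *)
Definition grid k (M : nat -> nat -> bool) : Prop :=
  exists r c : nat -> nat, forall a b, a < k -> b < k ->
    exists i j, [/\ r a <= i < r a.+1, c b <= j < c b.+1 & M i j].

Definition tr_rel (M : nat -> nat -> bool) : nat -> nat -> bool :=
  fun i j => M j i.

(** Contracts rows only; columns are contracted through the transpose. *)
Definition contract w (M : nat -> nat -> bool) : nat -> nat -> bool :=
  fun I j => [exists i : 'I_w, M (I * w + i) j].

Lemma grid_tr k M : grid k (tr_rel M) -> grid k M.
Proof.
move=> [r [c H]]; exists c, r => a b ak bk.
by have [i [j [Hi Hj Mij]]] := H b a bk ak; exists j, i.
Qed.

Lemma grid_contract k w M : grid k (contract w M) -> grid k M.
Proof.
move=> [r [c H]]; exists (fun a => r a * w), c => a b ak bk.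
have [I [j [/andP [HI1 HI2] Hj /existsP [i Mij]]]] := H a b ak bk.
exists (I * w + i), j; split => //; apply/andP; split.
  by rewrite (leq_trans _ (leq_addr _ _)) // leq_mul2r HI1 orbT.
apply: leq_trans (_ : I.+1 * w <= _); last by rewrite leq_mul2r HI2 orbT.
by rewrite mulSn addnC -addSn leq_add2r.
Qed.

Lemma grid_sorted k (M : nat -> nat -> bool) (e f : seq nat) :
  sorted ltn e -> sorted ltn f -> k <= size e -> k <= size f ->
  (forall i j, i \in e -> j \in f -> M i j) -> grid k M.
Proof.
(* The zones start at the elements of [e] and [f]. The default exceeds all elements, so it closes a
   zone starting at the last one. *)
pose d (s : seq nat) := (sumn s).+1.
have dP s x : x \in s -> x < d s.
  elim: s => // y s IH; rewrite inE => /orP [/eqP -> | /IH]; rewrite /d /=; lia.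
have zoneP s a : sorted ltn s -> a < size s ->
    nth (d s) s a < nth (d s) s a.+1.
  move=> ss ha; case: (ltnP a.+1 (size s)) => hb.
    by apply: (sorted_ltn_nth ltn_trans) => //; rewrite inE.
  by rewrite (nth_default _ hb); apply/dP/mem_nth.
move=> se sf ke kf H; exists (nth (d e) e), (nth (d f) f) => a b ak bk.
have ae := leq_trans ak ke; have bf := leq_trans bk kf.
exists (nth (d e) e a), (nth (d f) f b).
by split; rewrite ?leqnn ?zoneP //; apply: H; apply: mem_nth.
Qed.

Section Blocks.
Variables (k w : nat).

Definition block_cols M I J : {set 'I_w} :=
  [set j : 'I_w | contract w M I (J * w + j)].

(** Tall blocks need no separate notion: they are the wide blocks of the transpose. *)
Definition wide M I J := k <= #|block_cols M I J|.

Lemma sorted_enum_ord m (X : {set 'I_m}) (f : 'I_m -> nat) :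
  {homo f : x y / x < y} -> sorted ltn [seq f i | i <- enum X].
Proof.
move=> hf; rewrite sorted_map /enum_mem.
apply: sorted_filter => [y x z /=|]; last first.
  rewrite -enumT; apply: (@sub_sorted _ (relpre val ltn)) => [x y /= |].
    exact: hf.
  by rewrite -sorted_map val_enum_ord iota_ltn_sorted.
exact: ltn_trans.
Qed.

(* Wide blocks in the same column of blocks with the same non-empty columns form
   a grid: there are at most [2 ^ w] such sets of columns. *)
Lemma sum_wide M m J : ~ grid k M -> \sum_(I < m) wide M I J <= k * 2 ^ w.
Proof.
move=> ngrid.
have -> : \sum_(I < m) wide M I J =
    \sum_(Y : {set 'I_w}) #|[set I : 'I_m | wide M I J && (block_cols M I J == Y)]|.
  rewrite -big_mkcond /= (partition_big (fun I : 'I_m => block_cols M I J) predT) //=.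
  by apply: eq_bigr => Y _; rewrite -sum1_card; apply: eq_bigl => I; rewrite inE.
have -> : k * 2 ^ w = \sum_(Y : {set 'I_w}) k.
  by rewrite sum_nat_const -cardsT -powersetT card_powerset cardsT card_ord mulnC.
(* More than [k] block rows sharing a set [Y] of at least [k] columns give an all-ones submatrix of
   the matrix with contracted rows. *)
apply: leq_sum => Y _; rewrite leqNgt; apply/negP => kX.
set X := [set _ | _] in kX.
have [I0 XI0] : exists I0, I0 \in X.
  by apply/set0Pn; rewrite -card_gt0 (leq_ltn_trans _ kX).
have kY : k <= #|Y|.
  by move: XI0; rewrite inE /wide => /andP [h /eqP <-].
apply/ngrid/(@grid_contract _ w).
apply: (@grid_sorted k (contract w M) [seq val i | i : 'I_m <- enum X]
  [seq J * w + j | j : 'I_w <- enum Y]).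
- exact: sorted_enum_ord.
- by apply: sorted_enum_ord => x y; rewrite ltn_add2l.
- by rewrite size_map -cardE ltnW.
- by rewrite size_map -cardE.
move=> a b /mapP [I]; rewrite mem_enum => XI -> /mapP [j]; rewrite mem_enum => Yj ->.
by move: XI; rewrite inE => /andP [_ /eqP E]; move: Yj; rewrite -E inE.
Qed.

Definition block_sum (M : nat -> nat -> bool) I J : nat :=
  \sum_(i < w) \sum_(j < w) M (I * w + i) (J * w + j).

(** The ones of a block lie in the product of its non-empty rows and its non-empty columns. If the
    block is neither wide nor tall, both number at most [k.-1]. *)
Lemma block_sum_le M I J :
  block_sum M I J <= w ^ 2 * wide M I J + w ^ 2 * wide (tr_rel M) J I +
    k.-1 ^ 2 * contract w (tr_rel (contract w (tr_rel M))) I J.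
Proof.
have sum_set : block_sum M I J =
    #|[set ij : 'I_w * 'I_w | M (I * w + ij.1) (J * w + ij.2)]|.
  rewrite /block_sum pair_big /= -sum1_card big_mkcond /= [RHS]big_mkcond /=.
  by apply: eq_bigr => ij _; rewrite inE; case: (M _ _).
have sub : [set ij : 'I_w * 'I_w | M (I * w + ij.1) (J * w + ij.2)]
    \subset setX (block_cols (tr_rel M) J I) (block_cols M I J).
  apply/subsetP => -[i j]; rewrite !inE /contract /tr_rel /= => Mij.
  by apply/andP; split; apply/existsP; [exists j | exists i].
have := subset_leq_card sub; rewrite -sum_set cardsX => le.
have bw X : #|X : {set 'I_w}| <= w by rewrite -[X in _ <= X]card_ord max_card.
case W: (wide M I J).
  apply: leq_trans le _; apply: leq_trans (leq_mul (bw _) (bw _)) _.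
  by rewrite muln1 mulnn -addnA leq_addr.
case T: (wide (tr_rel M) J I).
  apply: leq_trans le _; apply: leq_trans (leq_mul (bw _) (bw _)) _.
  by rewrite muln0 muln1 mulnn add0n leq_addr.
rewrite !muln0 !add0n; case C: (contract _ _ _ _); last first.
  rewrite muln0 leqn0 sum_set cards_eq0; apply/eqP/setP => -[i j]; rewrite !inE /=.
  apply: contraFF C => Mij.
  by rewrite /contract /tr_rel; apply/existsP; exists i; apply/existsP; exists j.
rewrite muln1; apply: leq_trans le _; rewrite -mulnn.
move/negbT: W; move/negbT: T; rewrite /wide -!ltnNge => T W.
by apply: leq_mul; rewrite -ltnS (ltn_predK W).
Qed.

Lemma sum_mul m (F : nat -> nat) :
  \sum_(i < m * w) F i = \sum_(I < m) \sum_(i < w) F (I * w + i).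
Proof.
elim: m => [|m IH]; first by rewrite !big_ord0.
rewrite big_ord_recr /= -IH mulSn addnC big_split_ord /=.
by congr (_ + _).
Qed.

Lemma sum_block (M : nat -> nat -> bool) m :
  \sum_(i < m * w) \sum_(j < m * w) M i j = \sum_(I < m) \sum_(J < m) block_sum M I J.
Proof.
rewrite (sum_mul _ (fun i => \sum_(j < m * w) M i j)).
apply: eq_bigr => I _; rewrite /block_sum.
under eq_bigr => i _ do rewrite (sum_mul _ (fun j => M (I * w + i) j)).
by rewrite exchange_big.
Qed.
End Blocks.

(** With [w = k ^ 2], the wide and tall blocks of a matrix of side [m * w] contribute at most
    [mt_const k * m]. *)
Definition mt_const k := 2 * k * 2 ^ (k ^ 2) * (k ^ 2) ^ 2.

Lemma marcus_tardos_pow k s (M : nat -> nat -> bool) : 0 < k -> ~ grid k M ->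
  \sum_(i < (k ^ 2) ^ s) \sum_(j < (k ^ 2) ^ s) M i j <= mt_const k * (k ^ 2) ^ s.
Proof.
move=> k0; have c0 : 0 < mt_const k by rewrite !muln_gt0 !expn_gt0 k0.
elim: s M => [|s IH] M ng.
  by rewrite expn0 !big_ord1 muln1; case: (M _ _).
set w := k ^ 2 in IH *; set m := w ^ s in IH *.
have -> : w ^ s.+1 = m * w by rewrite expnS mulnC.
rewrite sum_block; set M' := contract w (tr_rel (contract w (tr_rel M))).
have ng' : ~ grid k M' by move=> /grid_contract /grid_tr /grid_contract /grid_tr.
have ngt : ~ grid k (tr_rel M) by move=> /grid_tr.
apply: (@leq_trans (\sum_(I < m) \sum_(J < m) (w ^ 2 * wide k w M I J +
    w ^ 2 * wide k w (tr_rel M) J I + k.-1 ^ 2 * M' I J))).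
  by apply: leq_sum => I _; apply: leq_sum => J _; apply: block_sum_le.
under eq_bigr => I _ do rewrite !big_split -!big_distrr /=.
rewrite !big_split -!big_distrr /=.
have W1 : \sum_(I < m) \sum_(J < m) wide k w M I J <= m * (k * 2 ^ w).
  rewrite exchange_big /= -[m in m * _]card_ord -sum_nat_const.
  by apply: leq_sum => J _; apply: sum_wide.
have W2 : \sum_(I < m) \sum_(J < m) wide k w (tr_rel M) J I <= m * (k * 2 ^ w).
  rewrite -[m in m * _]card_ord -sum_nat_const.
  by apply: leq_sum => I _; apply: sum_wide.
have := IH _ ng'; move: W1 W2.
set x := \sum_(I < m) _; set y := \sum_(I < m) _; set z := \sum_(I < m) _ => W1 W2 W3.
have W4 := leq_add (leq_add (leq_mul (leqnn (w ^ 2)) W1) (leq_mul (leqnn (w ^ 2)) W2))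
  (leq_mul (leqnn (k.-1 ^ 2)) W3).
apply: leq_trans W4 _.
have -> : w ^ 2 * (m * (k * 2 ^ w)) + w ^ 2 * (m * (k * 2 ^ w)) = mt_const k * m.
  by rewrite /mt_const -/w; lia.
(* The induction closes because the wide and tall blocks cost one share and the contracted matrix
   [k.-1 ^ 2] shares, out of the [k ^ 2] available. *)
have qw : 1 + k.-1 ^ 2 <= w by rewrite /w -(prednK k0) /=; lia.
have -> : mt_const k * m + k.-1 ^ 2 * (mt_const k * m) =
    mt_const k * (m * (1 + k.-1 ^ 2)) by lia.
by rewrite !leq_mul2l qw !orbT.
Qed.

(** Padding with zeros up to a power of [k ^ 2] multiplies the side by at most [k ^ 2]. *)
Lemma marcus_tardos k n (M : nat -> nat -> bool) : 1 < k -> ~ grid k M ->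
  \sum_(i < n) \sum_(j < n) M i j <= mt_const k * k ^ 2 * n.
Proof.
move=> k1 ng; case: n => [|n]; first by rewrite big_ord0.
set w := k ^ 2; have w1 : 1 < w by rewrite /w; nia.
have [s lo hi] : exists2 s, w ^ s <= w * n.+1 & n.+1 <= w ^ s.
  exists (trunc_log w n.+1).+1; last by apply/ltnW/trunc_log_ltn.
  by rewrite expnS leq_mul2l trunc_logP ?orbT.
pose M' i j := [&& i < n.+1, j < n.+1 & M i j].
have ng' : ~ grid k M'.
  move=> [r [c H]]; apply: ng; exists r, c => a b ak bk.
  by have [i [j [hi1 hj1 /and3P [_ _ Mij]]]] := H a b ak bk; exists i, j.
have sub (F : nat -> nat) : (forall i, n < i -> F i = 0) ->
    \sum_(i < w ^ s) F i = \sum_(i < n.+1) F i.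
  move=> F0; rewrite [RHS](big_ord_widen _ _ hi) [RHS]big_mkcond /=.
  by apply: eq_bigr => i _; case: ltnP => // /F0.
have := marcus_tardos_pow s (ltnW k1) ng'; rewrite -/w.
rewrite (sub (fun i => \sum_(j < w ^ s) M' i j)) => [|i ni]; last first.
  by apply: big1 => j _; rewrite /M' ltnNge ni.
move=> le; apply: leq_trans (_ : _ <= mt_const k * w ^ s) _; last first.
  by rewrite -mulnA leq_mul2l lo orbT.
apply: leq_trans le; rewrite leq_eqVlt; apply/orP; left; apply/eqP.
apply: eq_bigr => i _; rewrite (sub (fun j => M' i j)) => [|j nj]; last first.
  by rewrite /M' [j < _]ltnNge nj andbF.
by apply: eq_bigr => j _; rewrite /M' !ltn_ord.
Qed.

(** * Mixed minors from coloured vertices *)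

Section Mixed.
Variables (d : Order.disp_t) (V : finOrderType d) (E : rel V).

(* The submatrix with rows [X] and columns [a], [b] is mixed. *)
Definition mixed_pair (X : pred V) (a b : V) : bool :=
  [exists v, exists v', [&& X v, X v' & (E v a != E v' a) || (E v b != E v' b)]]
  && [exists v, X v && (E v a != E v b)].

Lemma mixed_pair_sub (X Y : pred V) a b :
  subpred X Y -> mixed_pair X a b -> mixed_pair Y a b.
Proof.
move=> XY /andP [/existsP [v /existsP [v' /and3P [h1 h2 h3]]] /existsP [u /andP [h4 h5]]].
apply/andP; split.
  by apply/existsP; exists v; apply/existsP; exists v'; rewrite !XY.
by apply/existsP; exists u; rewrite XY.
Qed.

(** Either all rows of [X] coincide on both columns, or the two columns coincide on [X]. *)
Lemma mixed_pair_agree (X : pred V) a b v v' : X v -> X v' -> ~~ mixed_pair X a b ->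
  E v a = E v' a -> E v b = E v' b.
Proof.
move=> Xv Xv'; rewrite negb_and => /orP [/existsPn h _ | /existsPn h].
  by have /existsPn /(_ v') := h v; rewrite Xv Xv' negb_or !negbK => /andP [_ /eqP].
by have := h v; have := h v'; rewrite Xv Xv' /= !negbK => /eqP <- /eqP <-.
Qed.

Lemma enum_val_surj (N : nat) (X : {set 'I_N}) i :
  i \in X -> exists i0 : 'I_#|X|, enum_val i0 = i.
Proof. by move=> iX; exists (enum_rank_in iX i); rewrite enum_rankK_in. Qed.

Lemma consecutive_partition_preim N t (h : 'I_N -> 'I_t) :
  {homo h : i j / i <= j} -> (forall a, exists i, h i = a) ->
  consecutive_partition t (preim_partition h [set: 'I_N]) /\
  forall X, X \in preim_partition h [set: 'I_N] -> exists a, X = [set i | h i == a].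
Proof.
move=> hm hs.
have eqP' X : reflect (exists a, X = [set i | h i == a])
    (X \in preim_partition h [set: 'I_N]).
  apply: (iffP imsetP) => [[i _ ->] | [a ->]].
    by exists (h i); apply/setP => j; rewrite !inE eq_sym.
  have [i <-] := hs a; exists i => //.
  by apply/setP => j; rewrite !inE eq_sym.
split; last by move=> X /eqP'.
apply/and3P; split; first exact: preim_partitionP.
  have -> : preim_partition h [set: 'I_N] = [set [set i | h i == a] | a : 'I_t].
    apply/setP => X; apply/eqP'/imsetP => [[a ->] | [a _ ->]]; by exists a.
  rewrite card_imset ?card_ord // => a b /setP ab.
  by have [i hi] := hs a; have := ab i; rewrite !inE hi eqxx => /esym/eqP.
apply/forall_inP => X /eqP' [a ->]; apply/forall_inP => i; rewrite inE => /eqP hi.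
apply/forall_inP => k; rewrite inE => /eqP hk; apply/forallP => j.
apply/implyP => /andP [ij jk]; rewrite inE -val_eqE eqn_leq /=.
by rewrite -{1}hk -{1}hi !hm.
Qed.

(** The parts are the colour classes, read on ranks. The mixed pairs also make both colourings
    surjective, and a zone containing a mixed submatrix is mixed. *)
Lemma mixed_minor_coloring t (h g : V -> 'I_t) :
  {homo h : u v / (u <= v)%O >-> u <= v} -> {homo g : u v / (u <= v)%O >-> u <= v} ->
  (forall a b, exists c c', [/\ g c = b, g c' = b & mixed_pair (fun v => h v == a) c c']) ->
  ~ mixed_free E t.
Proof.
move=> hm gm mix; apply.
pose h' (i : 'I_#|V|) := h (Order.enum_val i); pose g' (i : 'I_#|V|) := g (Order.enum_val i).
have hm' : {homo h' : i j / i <= j}.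
  by move=> i j ij; apply: hm; rewrite Order.le_enum_val.
have gm' : {homo g' : i j / i <= j}.
  by move=> i j ij; apply: gm; rewrite Order.le_enum_val.
have rk (v : V) : exists i : 'I_#|V|, Order.enum_val i = v.
  by exists (Order.enum_rank v); rewrite Order.enum_rankK.
have hs a : exists i, h' i = a.
  have [c [c' [_ _ /andP [_ /existsP [v /andP [/eqP hv _]]]]]] := mix a a.
  by have [i ei] := rk v; exists i; rewrite /h' ei.
have gs a : exists i, g' i = a.
  have [c [c' [hc _ _]]] := mix a a.
  by have [i ei] := rk c; exists i; rewrite /g' ei.
have [cP PE] := consecutive_partition_preim hm' hs.
have [cQ QE] := consecutive_partition_preim gm' gs.
exists (preim_partition h' [set: _]), (preim_partition g' [set: _]).
apply/and3P; split => //.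
apply/forall_inP => X /PE [a ->]; apply/forall_inP => Y /QE [b ->].
have [c [c' [gc gc' /andP [/existsP [v /existsP [v' /and3P [hv hv' ne]]]
  /existsP [u /andP [hu ne']]]]]] := mix a b.
have row x : h x == a ->
    exists i0 : 'I_#|[set i | h' i == a]|, Order.enum_val (enum_val i0) = x.
  move=> hx; have [i ei] := rk x; have iX : i \in [set i | h' i == a] by rewrite inE /h' ei.
  by have [i0 e0] := enum_val_surj iX; exists i0; rewrite e0.
have cols x : g x = b ->
    exists i0 : 'I_#|[set i | g' i == b]|, Order.enum_val (enum_val i0) = x.
  move=> hx; have [i ei] := rk x; have iX : i \in [set i | g' i == b] by rewrite inE /g' ei hx.
  by have [i0 e0] := enum_val_surj iX; exists i0; rewrite e0.
have [jc ejc] := cols _ gc; have [jc' ejc'] := cols _ gc'.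
have [iv eiv] := row _ hv; have [iv' eiv'] := row _ hv'; have [iu eiu] := row _ hu.
apply/andP; split; apply/forallP => H.
  have /forallP/(_ iv')/eqP/rowP H' := H iv.
  move: (H' jc) (H' jc'); rewrite !mxE eiv eiv' ejc ejc' => e1 e2.
  by move: ne; rewrite e1 e2 !eqxx.
have /forallP/(_ jc')/eqP/colP H' := H jc.
by move: (H' iu); rewrite !mxE eiu ejc ejc' => e1; move: ne'; rewrite e1 eqxx.
Qed.

(* Colour [a] consists of the points in exactly the first [a] of the up-sets
   [B 1], ..., [B t.-1]; the up-set [B 0] is irrelevant. *)
Definition color t (B : nat -> pred V) (v : V) : nat := \sum_(1 <= b < t) B b v.

Lemma color_lt t B v : 0 < t -> color t B v < t.
Proof.
move=> t0; rewrite /color -[X in _ < X](prednK t0) ltnS -subn1.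
apply: (@leq_trans (\sum_(1 <= b < t) 1)); first by apply: leq_sum => b _; case: (B b v).
by rewrite sum_nat_const_nat muln1.
Qed.

Lemma color_eq t (B : nat -> pred V) v a : a < t ->
  (forall b, 0 < b <= a -> B b v) -> (forall b, a < b < t -> ~~ B b v) -> color t B v = a.
Proof.
move=> at_ h1 h2; rewrite /color (big_cat_nat (n := a.+1)) //=.
rewrite [X in X + _](_ : _ = a) ?[X in _ + X](_ : _ = 0) ?addn0 //.
  by rewrite big_nat; apply: big1 => b /h2 /negbTE ->.
rewrite big_nat (eq_bigr (fun=> 1)) => [|b hb]; last by rewrite h1.
by rewrite -big_nat sum_nat_const_nat muln1 subn1.
Qed.

(** The up-sets need not be nested: counting those that contain a vertex is monotone in any case. *)
Lemma mixed_minor_upsets t (B C : nat -> pred V) : 0 < t ->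
  (forall b, {homo B b : u v / (u <= v)%O >-> u -> v}) ->
  (forall b, {homo C b : u v / (u <= v)%O >-> u -> v}) ->
  (forall a b, a < t -> b < t -> exists c c' (X : pred V),
     [/\ color t C c = b, color t C c' = b, forall v, X v -> color t B v = a
       & mixed_pair X c c']) ->
  ~ mixed_free E t.
Proof.
move=> t0 mB mC mix.
have mono (D : nat -> pred V) : (forall b, {homo D b : u v / (u <= v)%O >-> u -> v}) ->
    {homo (fun v => Ordinal (color_lt D v t0)) : u v / (u <= v)%O >-> u <= v}.
  move=> mD u v uv /=; apply: leq_sum => b _.
  by case D1: (D b u); case D2: (D b v) => //; move: (mD b _ _ uv D1); rewrite D2.
apply: (mixed_minor_coloring (mono _ mB) (mono _ mC)) => a b.
have [c [c' [X [cc cc' XB mXc]]]] := mix a b (ltn_ord a) (ltn_ord b).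
exists c, c'; split; try exact: val_inj.
by apply: mixed_pair_sub mXc => v /XB e; apply/eqP/val_inj.
Qed.
End Mixed.

(** * Definable cuts and the greedy partition *)

Lemma incr_le m (f : nat -> nat) : (forall x, x < m -> f x < f x.+1) ->
  forall x y, x <= y -> y <= m -> f x <= f y.
Proof.
move=> H x; elim=> [|y IH]; first by rewrite leqn0 => /eqP ->.
rewrite leq_eqVlt => /orP [/eqP -> //|xy] ym.
by apply: leq_trans (IH xy (ltnW ym)) (ltnW (H _ ym)).
Qed.

Section Chain.
Variables (d : Order.disp_t) (V : finOrderType d) (E : rel V) (t : nat).
Implicit Types (a b : 'I_t -> V).

(* [x] ends a sequence of [i] intervals, each mixed with every pair of columns
   [a l], [b l]. Successive intervals share an endpoint, so only every other one
   is used to build a minor, whence the bound [t.*2] on the length of chains. *)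
Fixpoint chain i a b (x : V) : bool :=
  if i is j.+1 then
    [exists y, chain j a b y &&
       [forall l, mixed_pair E (fun v => (y <= v <= x)%O) (a l) (b l)]]
  else true.

Lemma chain_ext i a b a' b' : a =1 a' -> b =1 b' -> chain i a b =1 chain i a' b'.
Proof.
move=> ea eb; elim: i => //= i IH x; apply: eq_existsb => y; rewrite IH.
by congr (_ && _); apply: eq_forallb => l; rewrite ea eb.
Qed.

Lemma chain_homo i a b : {homo chain i a b : u v / (u <= v)%O >-> u -> v}.
Proof.
case: i => //= i u v uv /existsP [y /andP [cy /forallP h]].
apply/existsP; exists y; rewrite cy; apply/forallP => l.
by apply: mixed_pair_sub (h l) => z /andP [-> /le_trans ->].
Qed.

Lemma chain_step i a b x y : chain i a b x ->
  (forall l, mixed_pair E (fun v => (x <= v <= y)%O) (a l) (b l)) -> chain i.+1 a b y.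
Proof. by move=> cx h; by apply/existsP; exists x; apply/andP; split => //; apply/forallP. Qed.

Lemma mixed_pair_itv_lt x y u v :
  mixed_pair E (fun v => (x <= v <= y)%O) u v -> (x < y)%O.
Proof.
move=> /andP [/existsP [w /existsP [w' /and3P [/andP [h1 h2] /andP [h3 h4] h5]]] _].
rewrite lt_def (le_trans h1 h2) andbT; apply/eqP => e.
have ew : w = x by apply/le_anti; rewrite h1 -e h2.
have ew' : w' = x by apply/le_anti; rewrite h3 -e h4.
by move: h5; rewrite ew ew' !eqxx.
Qed.

Lemma chain_seq i a b x : chain i a b x -> exists s : nat -> V, forall j, j < i ->
  forall l, mixed_pair E (fun v => (s j <= v <= s j.+1)%O) (a l) (b l).
Proof.
suff H : chain i a b x -> exists s : nat -> V, s i = x /\ forall j, j < i ->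
    forall l, mixed_pair E (fun v => (s j <= v <= s j.+1)%O) (a l) (b l).
  by move=> /H [s [_ hs]]; exists s.
elim: i x => [|i IH] x /=; first by move=> _; exists (fun=> x).
move=> /existsP [y /andP [/IH [s [sy hs]] /forallP h]].
exists (fun j => if j <= i then s j else x); split; first by rewrite ltnn.
move=> j; rewrite ltnS => ji l; rewrite /= ji.
have [lt_ji|le_ij] := ltnP j i; first exact: hs.
by rewrite (_ : j = i) ?sy //; lia.
Qed.

Lemma chain_bound a b x : 0 < t -> mixed_free E t ->
  (forall l, (a l <= b l)%O) -> (forall l l' : 'I_t, l < l' -> (b l < a l')%O) ->
  ~~ chain t.*2 a b x.
Proof.
move=> t0 mf ab ba; apply/negP => /chain_seq [s hs]; move: mf.
have s1 j : j < t.*2 -> (s j < s j.+1)%O.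
  by move=> /hs /(_ (Ordinal t0)) /mixed_pair_itv_lt.
have smono j j' : j <= j' -> j' <= t.*2 -> (s j <= s j')%O.
  elim: j' => [|j' IH]; first by rewrite leqn0 => /eqP ->.
  rewrite leq_eqVlt => /orP [/eqP -> //|jj'] h.
  by apply: le_trans (IH jj' (ltnW h)) (ltW (s1 _ h)).
(* Row part [i] is cut at [s i.*2], column part [j] at [a j]. The existential expresses the latter
   for natural number indices, the sequence [a] being increasing. *)
apply: (@mixed_minor_upsets _ _ E t (fun j v => (s j.*2 <= v)%O)
  (fun j v => [exists l : 'I_t, (j <= l) && (a l <= v)%O])) => //.
- by move=> j u v uv /le_trans; apply.
- move=> j u v uv /existsP [l /andP [jl al]]; apply/existsP; exists l.
  by rewrite jl (le_trans al).
move=> i j it jt; pose l := Ordinal jt.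
have cC c : (a l <= c <= b l)%O ->
    color t (fun j v => [exists l : 'I_t, (j <= l) && (a l <= v)%O]) c = j.
  move=> /andP [h1 h2]; apply: color_eq => // k /andP [hk1 hk2].
    by apply/existsP; exists l; rewrite hk2.
  apply/existsPn => l'; rewrite negb_and -implybE; apply/implyP => kl'.
  by rewrite -ltNge (le_lt_trans h2) // ba //= (leq_trans hk1).
exists (a l), (b l), (fun v => (s i.*2 <= v <= s i.*2.+1)%O); split.
- by apply: cC; rewrite lexx ab.
- by apply: cC; rewrite lexx ab.
- move=> v /andP [h1 h2]; apply: color_eq => // k /andP [hk1 hk2].
    by apply: le_trans h1; apply: smono; lia.
  rewrite -ltNge (le_lt_trans h2) //; apply: lt_le_trans (s1 _ _) _; first lia.
  by apply: smono; lia.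
by apply: hs; lia.
Qed.
End Chain.

(** * Bad pairs of consecutive columns *)

Section Columns.
Variables (d : Order.disp_t) (V : finOrderType d) (E : rel V).
Variables (A : {set V}) (a0 : V).
Local Notation n := #|A|.

(** Once the default [a0] is taken in [A], every index yields a legitimate parameter. *)
Definition nth_elt (j : nat) : V := nth a0 (sort <=%O%O (enum A)) j.
Local Notation al := nth_elt.

Lemma nth_elt_in j : a0 \in A -> al j \in A.
Proof.
move=> Aa0; rewrite /nth_elt; case: (ltnP j (size (sort <=%O%O (enum A)))) => h.
  by rewrite -mem_enum -(mem_sort <=%O%O) mem_nth.
by rewrite nth_default.
Qed.

Lemma nth_elt_lt i j : i < j -> j < n -> (al i < al j)%O.
Proof.
move=> ij jn.
have ss : sorted <%O%O (sort <=%O%O (enum A)).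
  by rewrite sort_lt_sorted enum_uniq.
have sz : size (sort <=%O%O (enum A)) = n by rewrite size_sort -cardE.
by apply: (sorted_ltn_nth lt_trans) => //; rewrite inE sz // (ltn_trans ij).
Qed.

Lemma nth_elt_le i j : i <= j -> j < n -> (al i <= al j)%O.
Proof. by rewrite leq_eqVlt => /orP [/eqP -> //|ij] /(nth_elt_lt ij) /ltW. Qed.

Lemma nth_eltP a : a \in A -> exists2 j, j < n & al j = a.
Proof.
move=> aA; have h : a \in sort <=%O%O (enum A) by rewrite mem_sort mem_enum.
exists (index a (sort <=%O%O (enum A))); last by rewrite /nth_elt nth_index.
by rewrite -index_mem size_sort -cardE in h.
Qed.

Definition bad (X : pred V) : seq nat :=
  [seq j <- iota 0 n.-1 | mixed_pair E X (al j) (al j.+1)].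

(** Agreement moves from left to right through the pairs that are not bad, and is assumed anew at
    the right column of each bad pair. *)
Lemma bad_agree (X : pred V) v v' : X v -> X v' -> E v (al 0) = E v' (al 0) ->
  (forall j, j \in bad X -> E v (al j.+1) = E v' (al j.+1)) ->
  neighbors E A v = neighbors E A v'.
Proof.
move=> Xv Xv' h0 h.
suff H j : j < n -> E v (al j) = E v' (al j).
  apply/setP => a; rewrite !inE; case aA: (a \in A) => //=.
  by have [j jn <-] := nth_eltP aA; apply: H.
elim: j => // j IH jn; case M: (mixed_pair E X (al j) (al j.+1)).
  by apply: h; rewrite mem_filter M mem_iota; lia.
by apply: (mixed_pair_agree Xv Xv' (negbT M)); apply: IH; lia.
Qed.

End Columns.

Section Blocks.
Variables (d : Order.disp_t) (V : finOrderType d) (E : rel V) (t : nat).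
Hypotheses (t0 : 0 < t) (mf : mixed_free E t).
Variables (A : {set V}) (a0 : V).
Hypothesis (Aa0 : a0 \in A).
Local Notation n := #|A|.
Local Notation al := (nth_elt A a0).
Local Notation bad := (bad E A a0).

(** With [t.*2] bad pairs, [t] disjoint ones are mixed on the interval from [x] to [y]. A chain
    ending at [x] then extends to [y], and the hypothesis brings the longer chain back to [x];
    iterating contradicts [chain_bound]. *)
Lemma bad_chain_bound (X : pred V) x y : X x -> X y -> subpred X (fun v => (x <= v <= y)%O) ->
  (forall i a b, i <= t.*2 -> (forall l, a l \in A) -> (forall l, b l \in A) ->
     @chain _ V E t i a b y -> chain E i a b x) ->
  size (bad X) < t.*2.
Proof.
move=> Xx Xy sub H; rewrite ltnNge; apply/negP => sz.
(* Neighbouring bad pairs may share a column, so every other one is taken. *)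
pose e := bad X; pose a (l : 'I_t) := al (nth 0 e l.*2).
pose b (l : 'I_t) := al (nth 0 e l.*2).+1.
have es : sorted ltn e by apply: sorted_filter (iota_ltn_sorted _ _); exact: ltn_trans.
have eP j : j < size e -> nth 0 e j < n.-1 /\
    mixed_pair E X (al (nth 0 e j)) (al (nth 0 e j).+1).
  by move=> /(mem_nth 0); rewrite mem_filter mem_iota => /andP [-> /andP [_ ->]].
have e_lt i j : i < j -> j < size e -> nth 0 e i < nth 0 e j.
  by move=> ij js; apply: (sorted_ltn_nth ltn_trans) => //; rewrite inE // (ltn_trans ij).
have ls (l : 'I_t) : l.*2 < size e by apply: leq_trans sz; have := ltn_ord l; lia.
have ab l : (a l <= b l)%O.
  by apply: nth_elt_le => //; have [] := eP _ (ls l); lia.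
have ba (l l' : 'I_t) : l < l' -> (b l < a l')%O.
  move=> ll'; have h' : l.*2.+1 < l'.*2 by lia.
  have := e_lt _ _ (leqnn l.*2.+1) (ltn_trans h' (ls l')).
  have := e_lt _ _ h' (ls l'); have [] := eP _ (ls l').
  by move=> h1 _ h2 h3; apply: nth_elt_lt; lia.
have aA l : a l \in A by exact: nth_elt_in.
have bA l : b l \in A by exact: nth_elt_in.
have := chain_bound x t0 mf ab ba; apply/negP/negPn.
suff C i : i <= t.*2 -> chain E i a b x by exact: C.
elim: i => // i IH it; apply: H => //; apply: chain_step (IH (ltnW it)) _ => l.
by have [_ m] := eP _ (ls l); apply: mixed_pair_sub m.
Qed.

(** A threshold codes the up-set [above], which begins where the greedy sequence of [th.2] intervals
    for the given [t] pairs ends. *)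
Definition threshold : finType := ({ffun 'I_t -> V * V} * 'I_(t.*2.+1))%type.
Definition over_A (th : threshold) : bool :=
  [forall l, ((th.1 l).1 \in A) && ((th.1 l).2 \in A)].
Definition above (th : threshold) : pred V :=
  chain E th.2 (fun l => (th.1 l).1) (fun l => (th.1 l).2).
Definition thresholds_at (v : V) : {set threshold} := [set th | over_A th & above th v].
(** The sets [thresholds_at] grow along the order, so two vertices have the same level exactly when
    no threshold separates them. *)
Definition level (v : V) : nat := #|thresholds_at v|.
Let K := #|{: threshold}|.

Lemma thresholds_at_homo u v : (u <= v)%O -> thresholds_at u \subset thresholds_at v.
Proof.
move=> uv; apply/subsetP => th; rewrite !inE => /andP [-> h].
exact: chain_homo uv h.
Qed.

Lemma level_homo : {homo level : u v / (u <= v)%O >-> u <= v}.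
Proof. by move=> u v /thresholds_at_homo /subset_leq_card. Qed.

Lemma level_max v : level v <= K.
Proof. exact: max_card. Qed.

(** The least and the greatest vertex of a level satisfy the same thresholds, so every chain over
    [A] reaching the latter reaches the former. *)
Lemma bad_level i : size (bad (fun v => level v == i)) < t.*2.
Proof.
case: (pickP (fun v => level v == i)) => [v0 hv0|none]; last first.
  rewrite (_ : bad _ = [::]) ?double_gt0 //.
  rewrite /bad -(filter_pred0 (iota 0 n.-1)); apply: eq_filter => j /=.
  by apply/negbTE; rewrite negb_and; apply/orP; right; apply/existsPn => v; rewrite none.
case: (@Order.TotalTheory.arg_minP _ V V v0 (fun v => level v == i) id hv0) => x /eqP hx minx.
case: (@Order.TotalTheory.arg_maxP _ V V v0 (fun v => level v == i) id hv0) => y /eqP hy maxy.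
apply: (@bad_chain_bound _ x y); rewrite ?hx ?hy ?eqxx //.
  by move=> v hv; apply/andP; split; [apply: minx | apply: maxy].
move=> i' a b it aA bA cy.
have it' : i' < t.*2.+1 by [].
pose th : threshold := ([ffun l => (a l, b l)], Ordinal it').
have ea : (fun l => (th.1 l).1) =1 a by move=> l; rewrite /= ffunE.
have eb : (fun l => (th.1 l).2) =1 b by move=> l; rewrite /= ffunE.
have thE : above th =1 chain E i' a b by exact: chain_ext.
have xy : (x <= y)%O by apply: minx; rewrite hy.
have /eqP eB : thresholds_at x == thresholds_at y.
  by rewrite eqEcard thresholds_at_homo //= -!/(level _) hx hy.
have : th \in thresholds_at y.
  by rewrite inE thE cy andbT; apply/forallP => l; rewrite ffunE /= aA bA.
by rewrite -eB inE thE => /andP [].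
Qed.

(* The thresholds are nested up-sets, so those between two successive levels all
   coincide: every cut of the levels is given by a single threshold. *)
Lemma level_cut (s : nat) : exists th, over_A th && [forall v, above th v == (s <= level v)].
Proof.
have ok (i : 'I_(t.*2.+1)) : over_A ([ffun=> (a0, a0)], i).
  by apply/forallP => l; rewrite ffunE /= Aa0.
case: (pickP (fun v => level v < s)) => [u0 hu0|hu]; last first.
  (* Chains of length 0 end everywhere: the cut lies below all vertices. *)
  exists ([ffun=> (a0, a0)], ord0); rewrite ok; apply/forallP => v.
  by rewrite leqNgt hu.
case: (pickP (fun v => s <= level v)) => [v0 hv0|hv]; last first.
  (* Two equal columns are never mixed, so no chain of length 1 exists: the cut lies above all
     vertices. *)
  exists ([ffun=> (a0, a0)], inord 1); rewrite ok; apply/forallP => v; rewrite hv eqbF_neg.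
  rewrite /above /= inordK; last by rewrite ltnS double_gt0.
  apply/existsPn => y; rewrite negb_and; apply/orP; right; apply/forallPn.
  exists (Ordinal t0); rewrite ffunE negb_and; apply/orP; right.
  by apply/existsPn => w; rewrite eqxx andbF.
case: (@Order.TotalTheory.arg_maxP _ V V u0 (fun v => level v < s) id hu0) => u hu maxu.
case: (@Order.TotalTheory.arg_minP _ V V v0 (fun v => s <= level v) id hv0) => v hv minv.
have : ~~ (thresholds_at v \subset thresholds_at u).
  apply/negP => /subset_leq_card; rewrite -!/(level _) leqNgt.
  by rewrite (leq_trans hu hv).
move=> /subsetPn [th]; rewrite !inE => /andP [oth hv1]; rewrite oth /= => hu1.
exists th; rewrite oth; apply/forallP => w; apply/eqP.
case: (leqP s (level w)) => hw.
  exact: chain_homo (minv _ hw) hv1.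
apply/negbTE; apply: contra hu1; exact/chain_homo/maxu.
Qed.

(** * Greedy merging of levels *)

Definition slice i j : pred V := fun v => i <= level v <= j.
(* The first summand is the density in the Marcus-Tardos theorem, the second
   makes single levels [small]. *)
Let p := mt_const t.*2 * t.*2 ^ 2 + t.*2.
Definition small i j := size (bad (slice i j)) <= p.
(** The search may start at 0, since slices with [j < i] are empty and hence small. If it fails it
    returns [K.+1], which is beyond every level. *)
Definition next i := find (fun j => ~~ small i j) (iota 0 K.+1).
Definition cut l := iter l next 0.

Lemma next_le i : next i <= K.+1.
Proof. by rewrite /next -[X in _ <= X](size_iota 0) find_size. Qed.

Lemma small_next i j : j < next i -> small i j.
Proof.
move=> h; have jK := leq_trans h (next_le i).
by have := before_find 0 h; rewrite nth_iota // add0n => /negbFE.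
Qed.

Lemma nsmall_next i : next i <= K -> ~~ small i (next i).
Proof.
move=> h.
have hs : has (fun j => ~~ small i j) (iota 0 K.+1).
  by rewrite has_find size_iota.
by have := nth_find 0 hs; rewrite -/(next i) nth_iota.
Qed.

Lemma small_empty i j : j < i -> small i j.
Proof.
move=> ji; rewrite /small /bad (eq_filter (a2 := pred0)) ?filter_pred0 // => l /=.
apply/negbTE; rewrite negb_and; apply/orP; right; apply/existsPn => v.
by apply/negP => /andP [/andP [h1 h2] _]; lia.
Qed.

Lemma small_refl i : small i i.
Proof.
rewrite /small /bad (eq_filter (a2 := fun j =>
  mixed_pair E (fun v => level v == i) (al j) (al j.+1))).
  by apply: leq_trans (ltnW (bad_level i)) (leq_addl _ _).
move=> j; apply/idP/idP; apply: mixed_pair_sub => v; rewrite /slice; lia.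
Qed.

Lemma next_gt i : i <= K -> i < next i.
Proof.
move=> iK; rewrite ltnNge; apply/negP => h.
have := nsmall_next (leq_trans h iK); move: h; rewrite leq_eqVlt.
by case/orP => [/eqP ->|/small_empty ->]; rewrite ?small_refl.
Qed.

Lemma cut_le l : cut l <= cut l.+1.
Proof.
rewrite /cut iterS; set i := iter _ _ _; case: (leqP i K) => h; first exact/ltnW/next_gt.
have iK : i <= K.+1 by rewrite /i; case: l @i {h} => //= l; apply: next_le.
rewrite leqNgt; apply/negP => h'.
have := nsmall_next (leq_trans h' iK); rewrite small_empty //.
Qed.

Lemma cut_homo : {homo cut : i j / i <= j}.
Proof. by apply: homo_leq => //; [exact: leq_trans | exact: cut_le]. Qed.

(* Successive slices share a level and successive pairs share a column; keeping
   the even zones of a [t.*2]-grid makes the zones disjoint. *)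
Lemma no_grid_slices : cut n <= K ->
  ~ grid t.*2 (fun l j => [&& l < n, j < n.-1 &
      mixed_pair E (slice (cut l) (cut l.+1)) (al j) (al j.+1)]).
Proof.
move=> cK [r [c H]]; move: mf.
have cut_lt i j : i < j -> j <= n -> cut i < cut j.
  move=> ij jn; apply: leq_trans (cut_homo ij).
  by apply: next_gt; apply: leq_trans cK; apply: cut_homo; lia.
have r_lt x : x < t.*2 -> r x < r x.+1.
  by move=> h; have [i [j [h1 _ _]]] := H x x h h; lia.
have c_lt x : x < t.*2 -> c x < c x.+1.
  by move=> h; have [i [j [_ h1 _]]] := H x x h h; lia.
have r_n x : x < t.*2 -> r x < n.
  by move=> h; have [i [j [h1 _ /and3P [h2 _ _]]]] := H x x h h; lia.
have c_n x : x < t.*2 -> c x < n.-1.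
  by move=> h; have [i [j [_ h1 /and3P [_ h2 _]]]] := H x x h h; lia.
apply: (@mixed_minor_upsets _ _ E t (fun b v => cut (r b.*2) <= level v)
  (fun b v => (al (c b.*2) <= v)%O)) => //.
- by move=> b u v uv h; apply: leq_trans h (level_homo uv).
- by move=> b u v uv /le_trans; apply.
move=> a b at_ bt; have at2 : a.*2 < t.*2 by lia.
have bt2 : b.*2 < t.*2 by lia.
have [l [j [hl hj /and3P [ln jn m]]]] := H _ _ at2 bt2.
have cC w : (al j <= w <= al j.+1)%O -> color t (fun b v => (al (c b.*2) <= v)%O) w = b.
  move=> /andP [h1 h2]; apply: color_eq => // k /andP [hk1 hk2].
    apply: le_trans h1; apply: nth_elt_le; last lia.
    by have := incr_le c_lt (_ : k.*2 <= b.*2) (ltnW bt2); lia.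
  rewrite -ltNge (le_lt_trans h2) //; apply: nth_elt_lt.
    have := incr_le c_lt (_ : b.*2.+2 <= k.*2) (_ : k.*2 <= t.*2).
    by have := c_lt b.*2.+1; lia.
  by have := c_n k.*2; lia.
have jj : (al j <= al j.+1)%O by apply: nth_elt_le; lia.
exists (al j), (al j.+1), (slice (cut l) (cut l.+1)); split => //.
- by apply: cC; rewrite lexx.
- by apply: cC; rewrite lexx jj.
move=> v /andP [h1 h2]; apply: color_eq => // k /andP [hk1 hk2].
  apply: leq_trans h1; apply: cut_homo.
  by have := incr_le r_lt (_ : k.*2 <= a.*2) (ltnW at2); lia.
rewrite -ltnNge; apply: leq_ltn_trans h2 _; apply: cut_lt.
  have := incr_le r_lt (_ : a.*2.+2 <= k.*2) (_ : k.*2 <= t.*2).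
  by have := r_lt a.*2.+1; lia.
by have := r_n k.*2; lia.
Qed.

Lemma cut_card : K < cut n.
Proof.
rewrite ltnNge; apply/negP => cK.
have n0 : 0 < n by apply/card_gt0P; exists a0.
have t2 : 1 < t.*2 by lia.
have := marcus_tardos n t2 (no_grid_slices cK); apply/negP; rewrite -ltnNge.
apply: (@leq_trans (\sum_(l < n) p.+1)).
  rewrite sum_nat_const card_ord mulnC ltn_pmul2l // /p; lia.
(* The closed slice, which includes level [cut l.+1], is not small and so has at least [p.+1] bad
   pairs. *)
apply: leq_sum => l _.
have hl : cut l.+1 <= K by apply: leq_trans cK; apply: cut_homo.
have := nsmall_next hl; rewrite -ltnNge => /leq_trans; apply.
rewrite /bad size_filter -sum1_count big_mkcond /= -/(index_iota 0 n.-1).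
rewrite -[X in _ <= X](big_mkord predT (fun j => nat_of_bool [&& l < n, j < n.-1 &
      mixed_pair E (slice (cut l) (cut l.+1)) (al j) (al j.+1)])).
(* There are only [n.-1] pairs; the last column is zero and makes the matrix square. *)
rewrite (big_cat_nat (n := n.-1)) //=; last exact: leq_pred.
apply: leq_trans (leq_addr _ _); rewrite -(subn0 n.-1) -/(index_iota 0 n.-1) subn0.
rewrite big_nat [X in _ <= X]big_nat; apply: leq_sum => j /andP [_ jn].
by rewrite jn ltn_ord /=; case: (mixed_pair _ _ _ _).
Qed.

Lemma cut_block v : exists l : 'I_n, cut l <= level v < cut l.+1.
Proof.
have : level v < cut n by apply: leq_ltn_trans (level_max v) cut_card.
elim: {1 3}n (leqnn n) => // m IH mn h; case: (leqP (cut m) (level v)) => h'.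
  by exists (Ordinal mn); rewrite h' h.
by apply: IH h'; apply: ltnW.
Qed.
End Blocks.

(** * Formulas *)

Definition shift n (i : 'I_n) : 'I_n.+1 := lift ord0 i.

Definition Top n : formula n := Not (Bot n).

Definition Iff n (p q : formula n) : formula n :=
  Or (And p q) (And (Not p) (Not q)).

Definition BigAnd n (I : Type) (s : seq I) (F : I -> formula n) : formula n :=
  foldr (fun i p => And (F i) p) (Top n) s.

Definition Between n (x y z : 'I_n) : formula n := And (Leq x y) (Leq y z).

(** Under the double quantifier, [shift ord0] is the outer row and [ord0] the inner one. *)
Definition MixedPair n (x y a b : 'I_n) : formula n :=
  And
    (Ex (Ex (And (Between (shift (shift x)) (shift ord0) (shift (shift y)))
      (And (Between (shift (shift x)) ord0 (shift (shift y)))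
        (Not (And (Iff (Adj (shift ord0) (shift (shift a))) (Adj ord0 (shift (shift a))))
          (Iff (Adj (shift ord0) (shift (shift b))) (Adj ord0 (shift (shift b))))))))))
    (Ex (And (Between (shift x) ord0 (shift y))
      (Not (Iff (Adj ord0 (shift a)) (Adj ord0 (shift b)))))).

Fixpoint Chain t i n (a b : 'I_t -> 'I_n) (x : 'I_n) : formula n :=
  if i is j.+1 then
    Ex (And (Chain j (fun l => shift (a l)) (fun l => shift (b l)) ord0)
      (BigAnd (enum 'I_t)
        (fun l => MixedPair ord0 (shift x) (shift (a l)) (shift (b l)))))
  else Top n.

Section Sat.
Variables (d : Order.disp_t) (V : finOrderType d) (E : rel V).

Lemma tnth_shift n (x : V) (w : n.-tuple V) i : tnth (cons_tuple x w) (shift i) = tnth w i.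
Proof. exact: tnthS. Qed.

Lemma sat_BigAnd n (I : Type) (s : seq I) (F : I -> formula n) w :
  sat E (BigAnd s F) w = all (fun i => sat E (F i) w) s.
Proof. by elim: s => //= i s ->. Qed.

Lemma sat_MixedPair n (x y a b : 'I_n) w : sat E (MixedPair x y a b) w =
  mixed_pair E (fun v => (tnth w x <= v <= tnth w y)%O) (tnth w a) (tnth w b).
Proof.
have negIff (p q : bool) : ~~ (p && q || ~~ p && ~~ q) = (p != q) by case: p; case: q.
rewrite /=; congr (_ && _); apply: eq_existsb => v; last by rewrite !tnth_shift !tnth0 negIff.
by apply: eq_existsb => v'; rewrite !tnth_shift !tnth0 negb_and !negIff.
Qed.

Lemma sat_Chain t i n (a b : 'I_t -> 'I_n) x w :
  sat E (Chain i a b x) w =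
  chain E i (fun l => tnth w (a l)) (fun l => tnth w (b l)) (tnth w x).
Proof.
elim: i n a b x w => //= i IH n a b x w; apply: eq_existsb => y.
rewrite IH sat_BigAnd tnth0; congr (_ && _).
  by apply: chain_ext => l; rewrite tnth_shift.
apply/allP/forallP => H l; [have := H l (mem_enum _ _) | move=> _; have := H l];
  by rewrite sat_MixedPair !tnth_shift tnth0.
Qed.
End Sat.

Lemma List_In_map (T : eqType) (U : Type) (F : T -> U) (s : seq T) x :
  x \in s -> List.In (F x) [seq F y | y <- s].
Proof.
elim: s => //= y s IH; rewrite inE => /orP [/eqP ->|/IH]; by [left | right].
Qed.

Section Cells.
Variables (t p : nat).

(* The parameters of a cell: two thresholds, then the columns at which the
   adjacency is prescribed. *)
Definition param : finType := ('I_t * bool * bool + 'I_p.+1)%type.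

Definition pvar (i : param) : 'I_(#|{: param}|.+1) := shift (enum_rank i).

(** What a cell needs besides parameters: two chain lengths and the prescribed adjacencies. The
    number of codes depends on [t] and [p] only, which makes the set of formulas finite and
    uniform. *)
Definition cell_code : finType := ('I_(t.*2.+1) * 'I_(t.*2.+1) * {ffun 'I_p.+1 -> bool})%type.

Definition cell_formula (c : cell_code) : formula #|{: param}|.+1 :=
  And
    (And (Chain c.1.1 (fun l => pvar (inl (l, false, false)))
                      (fun l => pvar (inl (l, false, true))) ord0)
         (Not (Chain c.1.2 (fun l => pvar (inl (l, true, false)))
                           (fun l => pvar (inl (l, true, true))) ord0)))
    (BigAnd (enum 'I_p.+1)
       (fun r => if c.2 r then Adj ord0 (pvar (inr r)) else Not (Adj ord0 (pvar (inr r))))).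

Definition param_tuple (T : Type) (F : param -> T) : #|{: param}|.-tuple T :=
  [tuple F (enum_val i) | i < #|{: param}|].

Lemma sat_cell_formula d (V : finOrderType d) (E : rel V) c (F : param -> V) v :
  sat E (cell_formula c) (cons_tuple v (param_tuple F)) =
  [&& chain E c.1.1 (fun l => F (inl (l, false, false))) (fun l => F (inl (l, false, true))) v,
      ~~ chain E c.1.2 (fun l => F (inl (l, true, false))) (fun l => F (inl (l, true, true))) v
    & [forall r, E v (F (inr r)) == c.2 r]].
Proof.
have tp i : tnth (cons_tuple v (param_tuple F)) (pvar i) = F i.
  by rewrite tnth_shift tnth_mktuple enum_rankK.
rewrite /= !sat_Chain sat_BigAnd tnth0 -andbA; congr [&& _, ~~ _ & _].
- by apply: chain_ext => l; rewrite tp.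
- by apply: chain_ext => l; rewrite tp.
apply/allP/forallP => H r; [have := H r (mem_enum _ _) | move=> _; have := H r];
  by case: (c.2 r); rewrite /= tp tnth0; case: (E _ _).
Qed.
End Cells.

Theorem theorem4 :
  forall t : nat, 0 < t ->
  exists (k m : nat) (Delta : seq (formula k.+1)),
  forall (d : Order.disp_t) (V : finOrderType d) (E : rel V),
  simple_graph E -> mixed_free E t ->
  forall A : {set V}, A != set0 ->
  exists (f : V -> k.-tuple V) (g : V -> formula k.+1),
    [/\ forall v : V, {subset f v <= A},
        forall v : V, List.In (g v) Delta,
        #|[set f v | v in [set: V]]| <= m * #|A|,
        forall v : V, sat E (g v) (cons_tuple v (f v))
      & forall v v' : V, sat E (g v) (cons_tuple v' (f v)) ->
          neighbors E A v = neighbors E A v'].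
Proof.
move=> t t0; pose p := mt_const t.*2 * t.*2 ^ 2 + t.*2.
(* The parameters will depend only on the block of a vertex, and there are [#|A|] blocks, so the
   factor is 1. *)
exists #|{: param t p}|, 1, [seq cell_formula c | c <- enum (cell_code t p)].
move=> d V E _ mf A /set0Pn [a0 Aa0].
have blk v : {l : 'I_#|A| | cut E t A a0 l <= level E t A v < cut E t A a0 l.+1}.
  exact/sigW/cut_block.
pose th s := xchoose (level_cut E t0 Aa0 s).
have thA s l : ((th s).1 l).1 \in A /\ ((th s).1 l).2 \in A.
  by have /andP [/forallP /(_ l) /andP] := xchooseP (level_cut E t0 Aa0 s).
have thP s v : above E (th s) v = (s <= level E t A v).
  by have /andP [_ /forallP /(_ v) /eqP] := xchooseP (level_cut E t0 Aa0 s).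
(* Blocks are half-open in the levels and slices closed, hence the predecessor. *)
pose X l := slice E t A (cut E t A a0 l) (cut E t A a0 l.+1).-1.
(* The columns that [bad_agree] asks for: the first one and the right column of each bad pair.
   Shorter lists are padded with column 0. *)
pose reps l := 0 :: [seq j.+1 | j <- bad E A a0 (X l)].
pose F (l : nat) (i : param t p) : V :=
  match i with
  | inl (j, upper, snd) =>
      let u := (th (cut E t A a0 (if upper then l.+1 else l))).1 j in
      if snd then u.2 else u.1
  | inr r => nth_elt A a0 (nth 0 (reps l) r)
  end.
(* Only the adjacency bits depend on [v] itself rather than on its block. *)
pose code l v : cell_code t p :=
  ((th (cut E t A a0 l)).2, (th (cut E t A a0 l.+1)).2, [ffun r => E v (F l (inr r))]).
pose L v : 'I_#|A| := sval (blk v).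
have LP v : cut E t A a0 (L v) <= level E t A v < cut E t A a0 (L v).+1.
  exact: svalP (blk v).
have satE l v u : sat E (cell_formula (code l v)) (cons_tuple u (param_tuple (F l))) =
    [&& cut E t A a0 l <= level E t A u, level E t A u < cut E t A a0 l.+1 &
        [forall r, E u (F l (inr r)) == E v (F l (inr r))]].
  rewrite sat_cell_formula /= -!/(above E (th _) u) !thP -ltnNge.
  by congr [&& _, _ & _]; apply: eq_forallb => r; rewrite ffunE.
exists (fun v => param_tuple (F (L v))), (fun v => cell_formula (code (L v) v)); split.
- move=> v a /tnthP [i ->]; rewrite tnth_mktuple.
  case: (enum_val i) => [[[j []] []] | r] /=;
    by [exact: nth_elt_in | exact: (proj1 (thA _ _)) | exact: (proj2 (thA _ _))].
- by move=> v; apply: List_In_map; rewrite mem_enum.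
- rewrite mul1n -[X in _ <= X]card_ord.
  apply: leq_trans (leq_imset_card (fun l : 'I_#|A| => param_tuple (F l)) predT).
  apply/subset_leq_card/subsetP => _ /imsetP [v _ ->].
  by apply: imset_f.
- by move=> v; rewrite satE; have /andP [-> ->] := LP v; apply/forallP.
move=> v v'; rewrite satE => /and3P [h1 h2 /forallP h3].
have /andP [h4 h5] := LP v.
have agree j : j \in reps (L v) -> E v (nth_elt A a0 j) = E v' (nth_elt A a0 j).
  move=> jr; have js : index j (reps (L v)) < p.+1.
    apply: (@leq_trans (size (reps (L v)))); first by rewrite index_mem.
    (* The block stops just before [cut (L v).+1], so it is small and all its representatives fit
       among the [p.+1] parameters. *)
    rewrite /= ltnS size_map; apply: small_next.
    by rewrite prednK //; apply: leq_ltn_trans h5.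
  have /eqP := h3 (Ordinal js); rewrite /F nth_index //.
have XX u : cut E t A a0 (L v) <= level E t A u -> level E t A u < cut E t A a0 (L v).+1 ->
    X (L v) u.
  by move=> le lt; apply/andP; split => //; lia.
apply: (bad_agree (XX _ h4 h5) (XX _ h1 h2)).
  by apply: agree; rewrite inE.
by move=> j jb; apply: agree; rewrite inE /= map_f.
Qed.
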